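(* Let $(X,d)$ be a nonempty compact metric space and let $\mathcal{F}=\{X; f_{\lambda}\mid\lambda\in\Lambda\}$ be a chain transitive iterated function system of continuous maps, with $\Lambda$ finite and nonempty. Then either (a) there is an integer $k\ge 1$ such that the relation $\sim$ on $X$ has exactly $k$ equivalence classes, these classes are closed and open in $X$, $\mathcal{F}$ cyclically permutes them, and $\mathcal{F}^{k}$ restricted to each equivalence class is chain mixing; or (b) $\mathcal{F}$ factors to an adding machine map.
   Context: An iterated function system (IFS) $\mathcal{F}=\{X; f_{\lambda}\mid\lambda\in\Lambda\}$ is a family of continuous maps $f_\lambda:X\to X$ indexed by a finite nonempty set $\Lambda$. For $\epsilon>0$, an $\epsilon$-chain of $\mathcal{F}$ from $x$ to $y$ of length $n\ge 1$ is a finite sequence $x=x_0,x_1,\dots,x_n=y$ in $X$ for which there exist $\lambda_0,\dots,\lambda_{n-1}\in\Lambda$ with $d(x_{i+1},f_{\lambda_i}(x_i))<\epsilon$ for all $0\le i<n$. $\mathcal{F}$ is chain transitive if for all $x,y\in X$ and every $\epsilon>0$ there is an $\epsilon$-chain from $x$ to $y$. $\mathcal{F}$ is chain mixing if for every $\epsilon>0$ there is $N>0$ such that for all $x,y\in X$ and every $n>N$ there is an $\epsilon$-chain from $x$ to $y$ of length exactly $n$. For an integer $k\ge 1$, $\mathcal{F}^{k}$ is the IFS of all compositions $f_{\lambda_{k}}\circ\cdots\circ f_{\lambda_{1}}$ with $\lambda_1,\dots,\lambda_k\in\Lambda$. If $E\subset X$ is mapped into itself by all maps of $\mathcal{F}^k$,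 the restriction of $\mathcal{F}^k$ to $E$ is the IFS on $E$ formed by the restricted maps. For a chain transitive $\mathcal{F}$ and $\epsilon>0$, let $k_\epsilon$ be the greatest common divisor of the lengths of all $\epsilon$-chains from $x$ to itself; this number does not depend on $x\in X$. Write $a\sim_\epsilon b$ if there is an $\epsilon$-chain from $a$ to $b$ of length $mk_\epsilon$ for some integer $m>0$; this is an equivalence relation. Write $a\sim b$ if $a\sim_\epsilon b$ for every $\epsilon>0$. $\mathcal{F}$ cyclically permutes $k$ pairwise disjoint sets if they can be enumerated as $E_0,\dots,E_{k-1}$ so that $f_\lambda(E_j)\subset E_{(j+1) \bmod k}$ for all $\lambda\in\Lambda$ and all $j$. Adding machine map: let $\alpha=(j_1,j_2,\dots)$ be a sequence of integers $j_i\ge 2$. Let $\Delta_\alpha$ be the set of sequences $(x_1,x_2,\dots)$ with $x_i\in\{0,\dots,j_i-1\}$, with metric $d_\alpha(x,y)=\sum_{i\ge1}\delta(x_i,y_i)/2^i$, where $\delta(a,b)=1$ if $a\ne b$ and $0$ if $a=b$. Addition on $\Delta_\alpha$ is coordinatewise modulo $j_i$ with carry to the right: $(x)+(y)=(z)$ where $t_0=0$, $z_i=(x_i+y_i+t_{i-1}) \bmod j_i$, and $t_i=1$ if $x_i+y_i+t_{i-1}\ge j_i$, $t_i=0$ otherwise. The adding machine map is $g_\alpha:\Delta_\alpha\to\Delta_\alpha$, $g_\alpha(x)=x+(1,0,0,\dots)$. $\mathcal{F}$ factors to an adding machine map if there are such an $\alpha$ and a continuous surjection $h:X\to\Delta_\alpha$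 with $h\circ f_\lambda=g_\alpha\circ h$ for all $\lambda\in\Lambda$. *)

(* Defs.v *)
From HB Require Import structures.
From mathcomp Require Import all_boot all_order all_algebra.
From mathcomp Require Import all_classical all_reals all_analysis.

Set Implicit Arguments.
Unset Strict Implicit.
Unset Printing Implicit Defensive.

Import Order.TTheory GRing.Theory Num.Theory.
Import numFieldNormedType.Exports.

Local Open Scope classical_set_scope.
Local Open Scope ring_scope.

Section subset_metric.
Context {R : realType} {X : metricType R} (A : set X).

Let set_dist (x y : A) : R := mdist (set_val x) (set_val y).

Let set_dist_ge0 x y : 0 <= set_dist x y.
Proof. exact: mdist_ge0. Qed.

Let set_dist_positivity x y : set_dist x y = 0 -> x = y.
Proof. by move=> /mdist_positivity/val_inj. Qed.

Let ballEset_dist x d : ball x d = [set y : A | set_dist x y < d].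
Proof.
transitivity (set_val @^-1` (ball (set_val x) d) : set A); first by [].
by rewrite ballEmdist.
Qed.

HB.instance Definition _ := @PseudoMetric_isMetric.Build R A
  set_dist set_dist_ge0 set_dist_positivity ballEset_dist.

End subset_metric.

(* An iterated function system on X is given by its family of maps
   F : L -> X -> X, with L : finType; nonemptiness of L and continuity of the
   maps are hypotheses of the theorem. *)

Section chains.
Context {R : realType} {X : metricType R} {L : finType} (F : L -> X -> X).
Implicit Types (e : R) (x y : X) (n k : nat).

Definition eps_step e x y : bool := [exists l, mdist y (F l x) < e].

Definition eps_chain e n x y : Prop :=
  (0 < n)%N /\
  exists p : seq X, [/\ size p = n, path (eps_step e) x p & last x p = y].

Definition chain_transitive : Prop :=
  forall x y e, 0 < e -> exists n, eps_chain e n x y.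

Definition chain_mixing : Prop :=
  forall e, 0 < e -> exists2 N, (0 < N)%N &
    forall x y n, (N < n)%N -> eps_chain e n x y.

Definition loop_lengths e x : set nat := [set n | eps_chain e n x x].

Definition is_gcd (S : set nat) (g : nat) : Prop :=
  (forall n, S n -> (g %| n)%N) /\
  (forall d, (forall n, S n -> (d %| n)%N) -> (d <= g)%N).

(* The default value 0 is never reached when F is chain transitive and X is
   nonempty, see chain_periodP below. *)
Definition chain_period e : nat :=
  xget 0%N [set k | forall x, is_gcd (loop_lengths e x) k].

Definition eps_sim e x y : Prop :=
  exists2 m, (0 < m)%N & eps_chain e (m * chain_period e) x y.

Definition chain_sim x y : Prop := forall e, 0 < e -> eps_sim e x y.

Definition chain_class x : set X := [set y | chain_sim x y].

Definition chain_classes : set (set X) := range chain_class.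

End chains.

Section chain_period_theory.
Context {R : realType} {X : metricType R} {L : finType} (F : L -> X -> X).
Implicit Types (e : R) (x y : X) (n k : nat).

Lemma eps_chain_trans e n k x y z :
  eps_chain F e n x y -> eps_chain F e k y z -> eps_chain F e (n + k) x z.
Proof.
move=> [n0 [p [sp px lp]]] [k0 [q [sq qy lq]]]; split.
  by rewrite addn_gt0 n0.
by exists (p ++ q); rewrite size_cat cat_path last_cat lp px sp sq.
Qed.

Lemma chain_periodP e x : chain_transitive F -> 0 < e ->
  is_gcd (loop_lengths F e x) (chain_period F e).
Proof.
move=> FT e0.
have dvdS y z d : (forall n, loop_lengths F e y n -> (d %| n)%N) ->
    forall n, loop_lengths F e z n -> (d %| n)%N.
  move=> dy n zn; have [a yz] := FT y z e e0; have [b zy] := FT z y e e0.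
  have /dy d1 := eps_chain_trans yz zy.
  have /dy := eps_chain_trans (eps_chain_trans yz zn) zy.
  by rewrite addnAC dvdn_addr.
suff [g gx] : exists g, is_gcd (loop_lengths F e x) g.
  rewrite /chain_period; case: xgetP => [k _ /(_ x) //|/(_ g)[]].
  move=> y; case: gx => g1 g2; split; first exact: dvdS g1.
  by move=> d /(dvdS _ x) /g2.
have [N xN] := FT x x e e0.
pose P d := `[< forall n, loop_lengths F e x n -> (d %| n)%N >].
have exP : exists d, P d by exists 1%N; apply/asboolP => n _; exact: dvd1n.
have PN d : P d -> (d <= N)%N.
  by move=> /asboolP/(_ _ xN); apply: dvdn_leq; case: xN.
case: (ex_maxnP exP PN) => g /asboolP g1 g2; exists g; split => // d dx.
by apply: g2; apply/asboolP.
Qed.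

End chain_period_theory.

Section power_restriction.
Context {X : Type} {L : finType} (F : L -> X -> X).

(* foldl applies F (tnth t 0) first *)
Definition ifs_power (k : nat) (t : k.-tuple L) (x : X) : X :=
  foldl (fun y l => F l y) x t.

Definition ifs_restrict (E : set X) (FE : forall l, set_fun E E (F l))
    (l : L) (x : E) : E :=
  SigSub (mem_set (FE l (set_val x) (set_valP x))).

(* ordS j is j.+1 modulo k *)
Definition cyclically_permutes (k : nat) (C : set (set X)) : Prop :=
  exists E : 'I_k -> set X,
    [/\ set_bij setT C E, trivIset setT E &
        forall l j, F l @` E j `<=` E (ordS j)].

End power_restriction.

Definition power_chain_mixing_on {R : realType} {X : metricType R}
    {L : finType} (F : L -> X -> X) (k : nat) (E : set X) : Prop :=
  exists FE : forall t : k.-tuple L, set_fun E E (ifs_power F t),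
    chain_mixing (ifs_restrict FE).

(* Coordinates are numbered from 0: the i-th digit here is the digit x_{i+1},
   with base j_{i+1} = a i. R only serves to fix where distances live. *)
Definition adding_space (R : realType) (a : nat -> nat) : Type :=
  forall i, 'I_(a i).

Section adding_metric.
Context {R : realType} {a : nat -> nat}.
Implicit Types x y z : adding_space R a.

HB.instance Definition _ := gen_eqMixin (adding_space R a).
HB.instance Definition _ := gen_choiceMixin (adding_space R a).

Definition adding_dist x y : R :=
  limn [series ((x i != y i)%:R / 2 ^+ i.+1 : R)]_i.

Let term x y : R^nat := fun i => (x i != y i)%:R / 2 ^+ i.+1.

Let term_ge0 x y i : 0 <= term x y i.
Proof. by rewrite divr_ge0 ?ler0n ?exprn_ge0. Qed.

Let cvg_term x y : cvgn (series (term x y)).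
Proof.
apply: (@series_le_cvg _ _ (geometric 2^-1 2^-1)) => [i|i|i|].
- exact: term_ge0.
- by rewrite /geometric /= mulr_ge0 ?exprn_ge0.
- rewrite /term /geometric /= exprS invfM -exprVn ler_piMl ?mulr_ge0 ?exprn_ge0//.
  by rewrite lern1 leq_b1.
- apply: is_cvg_geometric_series; rewrite ger0_norm//.
  by rewrite invf_lt1// ltr1n.
Qed.

Let adding_distE x y : adding_dist x y = limn (series (term x y)).
Proof. by []. Qed.

Let adding_distxx x : adding_dist x x = 0.
Proof.
rewrite adding_distE.
have -> : series (term x x) = cst 0; last exact: lim_cst.
apply/funext => n; rewrite /series /= big1// => i _.
by rewrite /term eqxx mul0r.
Qed.

Let adding_dist_positivity x y : adding_dist x y = 0 -> x = y.
Proof.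
move=> xy0; apply/functional_extensionality_dep => i; apply/eqP/negPn/negP => xyi.
have : series (term x y) i.+1 <= adding_dist x y.
  apply: nondecreasing_cvgn_le; last exact: cvg_term.
  by apply/nondecreasing_seqP => n; rewrite /series /= big_nat_recr//= lerDl.
rewrite xy0 leNgt /series /= big_nat_recr//= => /negP; apply.
rewrite ltr_wpDl ?sumr_ge0// /term xyi divr_gt0// ?exprn_gt0//.
Qed.

Let adding_dist_sym x y : adding_dist x y = adding_dist y x.
Proof.
by rewrite !adding_distE; congr (limn (series _)); apply/funext => i;
  rewrite /term eq_sym.
Qed.

Let adding_dist_triangle y x z :
  adding_dist x z <= adding_dist x y + adding_dist y z.
Proof.
rewrite !adding_distE -lim_seriesD; [|exact: cvg_term..].
apply: ler_lim; [exact: cvg_term|exact/is_cvg_seriesD/cvg_term/cvg_term|].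
apply: nearW => n; apply: ler_sum => i _; rewrite /term /= -mulrDl.
rewrite ler_pM2r ?invr_gt0 ?exprn_gt0//.
rewrite [leRHS](_ : _ = ((x i != y i) + (y i != z i))%:R); last first.
  by rewrite natrD.
rewrite ler_nat.
by case: (eqVneq (x i) (y i)) => [->|_]; rewrite ?add0n// (leq_trans (leq_b1 _)).
Qed.

HB.instance Definition _ := @isMetric.Build R (adding_space R a) adding_dist
  adding_distxx adding_dist_positivity adding_dist_sym adding_dist_triangle.

End adding_metric.

Section adding_machine.
Context {R : realType} {a : nat -> nat}.

(* adding_carry x y i is the carry into coordinate i, i.e. t_i *)
Fixpoint adding_carry (x y : adding_space R a) (i : nat) : bool :=
  if i is i'.+1 then (a i' <= x i' + y i' + adding_carry x y i')%N else false.

Definition adding_add (x y : adding_space R a) : adding_space R a := fun i =>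
  Ordinal (ltn_pmod (x i + y i + adding_carry x y i)
                    (leq_ltn_trans (leq0n (x i)) (ltn_ord (x i)))).

(* (1, 0, 0, ...), through the coercion from bool to nat *)
Definition adding_one (a_gt1 : forall i, (1 < a i)%N) : adding_space R a :=
  fun i => Ordinal (leq_ltn_trans (leq_b1 (i == 0%N)) (a_gt1 i)).

Definition adding_map (a_gt1 : forall i, (1 < a i)%N)
  (x : adding_space R a) : adding_space R a := adding_add x (adding_one a_gt1).

End adding_machine.

Definition factors_to_adding_machine {R : realType} {X : metricType R}
    {L : finType} (F : L -> X -> X) : Prop :=
  exists (a : nat -> nat) (a_gt1 : forall i, (1 < a i)%N)
         (h : X -> adding_space R a),
    [/\ continuous h, set_surj setT setT h &
        forall l, h \o F l = adding_map a_gt1 \o h].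

(* Main.v *)
(* Fix x0 in X.  The lengths of the e-chains from x0 to x all lie in one class
   modulo k_e, the phase of x; it is locally constant, every f_l increases it by
   1, and k_e divides k_d for d <= e, where the d-phase reduces to the e-phase.
   The fibres of the e-phase are the classes of ~_e.

   If k_e is maximal, equal to k, at some e, then the phases for all smaller
   scales coincide, so the classes of ~ are the k fibres of the e-phase.  By
   compactness all points are linked to and from x0 by d-chains of bounded
   length, and the lengths of loops at x0 contain all large multiples of k, so
   that two points of equal phase are linked by d-chains of every large length
   divisible by k; uniform continuity turns these into chains of F^k.

   Otherwise there are e_0 > e_1 > ... with strictly increasing periods, and the
   digits of the e_i-phases in the mixed radix system with bases
   k_{e_{i+1}} / k_{e_i} form a factor map onto an adding machine. *)
Require Import Defs.
From mathcomp Require Import all_boot all_order all_algebra.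
From mathcomp Require Import all_classical all_reals all_analysis.

Set Implicit Arguments.
Unset Strict Implicit.
Unset Printing Implicit Defensive.

Import Order.TTheory GRing.Theory Num.Theory.
Import numFieldNormedType.Exports.

Local Open Scope classical_set_scope.
Local Open Scope ring_scope.

(* The least positive difference of two elements of S divides every element of
   S, hence is g. *)
Lemma numerical_semigroup (S : set nat) (g : nat) :
  is_gcd S g -> (0 < g)%N -> S 0%N ->
  (forall m n, S m -> S n -> S (m + n)%N) ->
  exists N, forall n, (N <= n)%N -> S (n * g)%N.
Proof.
move=> [gS gmax] g_gt0 S0 SD.
have SM m n : S n -> S (m * n)%N.
  by move=> Sn; elim: m => [//|m IHm]; rewrite mulSn; exact: SD.
pose D d := `[< (0 < d)%N /\ exists2 a, S a & S (a + d)%N >].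
have [s Ss s_gt0] : exists2 s, S s & (0 < s)%N.
  apply: contrapT => S_eq0; have : (g < g)%N; last by rewrite ltnn.
  apply: gmax => -[|n] Sn; first exact: dvdn0.
  by case: S_eq0; exists n.+1.
have exD : exists d, D d by exists s; apply/asboolP; split => //; exists 0%N.
case: (ex_minnP exD) => d /asboolP[d_gt0 [a Sa Sad]] d_min.
have dS n : S n -> (d %| n)%N.
  move=> Sn; rewrite /dvdn -leqn0 leqNgt; apply/negP => r_gt0.
  have := ltn_pmod n d_gt0; rewrite ltnNge => /negP; apply.
  apply: d_min; apply/asboolP; split => //.
  (* Adding the remainder [n %% d] to this witness gives [n %/ d * a + n], again in [S], so a
     nonzero remainder would be a difference smaller than [d]. *)
  exists (n %/ d * (a + d))%N; first exact: SM.
  by rewrite mulnDr -addnA -divn_eq; apply: SD => //; exact: SM.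
have gd : d = g.
  apply/eqP; rewrite eqn_leq gmax//= dvdn_leq//.
  by rewrite -(dvdn_addr d (gS _ Sa)) gS.
subst d; have /dvdnP[c ac] := gS _ Sa.
(* From [c * c] on, the quotient of [n] by [c] is at least the remainder, so [n * g] is a
   nonnegative combination of [a = c * g] and [a + g]. *)
exists (c * c)%N => n ccn.
have [c0|c_gt0] := posnP c.
  by apply: SM; rewrite -[g]add0n; move: Sad; rewrite ac c0 mul0n.
have rq : (n %% c <= n %/ c)%N.
  by rewrite (leq_trans (ltnW (ltn_pmod _ c_gt0)))// leq_divRL.
have -> : (n * g = (n %/ c - n %% c) * a + n %% c * (a + g))%N.
  rewrite mulnDr addnA -mulnDl subnK// {1}(divn_eq n c) mulnDl ac.
  by rewrite mulnA.
by apply: SD; exact: SM.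
Qed.

(** * Chains, periods and phases *)

Section phase.
Context {R : realType} {X : metricType R} {L : finType} (F : L -> X -> X).
Implicit Types (e d : R) (x y z : X) (n m k : nat).

Lemma near_mdist_lt e y z : mdist y z < e -> \forall y' \near y, mdist y' z < e.
Proof.
move=> yze; apply/metricType_numDomainType.nbhs_mdistP.
exists (e - mdist y z) => /=; first by rewrite subr_gt0.
move=> y' /=; rewrite metric_sym ltrBrDr => ?.
by rewrite (le_lt_trans (metric_triangle _ y _)).
Qed.

Lemma eps_chain_rcons e n x y : eps_chain F e n.+1 x y ->
  exists p z, [/\ size p = n, path (eps_step F e) x p, last x p = z &
    eps_step F e z y].
Proof.
move=> [_ [p []]]; case/lastP: p => // p w.
rewrite size_rcons rcons_path last_rcons => -[pn] /andP[xp pw] <-.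
by exists p, (last x p).
Qed.

Lemma eps_chain_cons e n x y : eps_chain F e n.+1 x y ->
  exists z p, [/\ size p = n, eps_step F e x z, path (eps_step F e) z p &
    last z p = y].
Proof.
move=> [_ [[|z p] []//]] => -[pn] /= /andP[xz zp] py.
by exists z, p.
Qed.

Lemma eps_chain_split e n m x y : (0 < n)%N -> (0 < m)%N ->
  eps_chain F e (n + m) x y ->
  exists2 z, eps_chain F e n x z & eps_chain F e m z y.
Proof.
move=> n0 m0 [_ [p [pnm]]]; rewrite -(cat_take_drop n p) cat_path last_cat.
move=> /andP[xp py] py'; exists (last x (take n p)).
  by split=> //; exists (take n p); rewrite size_takel// pnm leq_addr.
by split=> //; exists (drop n p); rewrite size_drop pnm addKn.
Qed.

Lemma eps_chain_le d e n x y : d <= e -> eps_chain F d n x y ->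
  eps_chain F e n x y.
Proof.
move=> de [n0 [p [pn xp py]]]; split=> //; exists p; split=> //.
apply: sub_path xp => u v /existsP[l uvl]; apply/existsP; exists l.
exact: lt_le_trans uvl de.
Qed.

Lemma eps_chain_map e l x : 0 < e -> eps_chain F e 1 x (F l x).
Proof.
move=> e0; split=> //; exists [:: F l x]; split=> //=.
by rewrite andbT; apply/existsP; exists l; rewrite mdistxx.
Qed.

(** Only the last step involves the endpoint, and its inequality is strict. *)
Lemma near_eps_chainr e n x y : eps_chain F e n x y ->
  \forall y' \near y, eps_chain F e n x y'.
Proof.
case: n => [[]//|n] /eps_chain_rcons[p [z [pn xp pz /existsP[l yl]]]].
near=> y'; split=> //; exists (rcons p y').
rewrite size_rcons rcons_path last_rcons pn xp; split=> //=.
by apply/existsP; exists l; rewrite pz; near: y'; exact: near_mdist_lt.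
Unshelve. all: by end_near. Qed.

Lemma near_eps_chainl e n x y : (forall l, continuous (F l)) ->
  eps_chain F e n x y -> \forall x' \near x, eps_chain F e n x' y.
Proof.
move=> F_cont; case: n => [[]//|n].
move=> /eps_chain_cons[z [p [pn /existsP[l xz] zp py]]].
rewrite metric_sym in xz.
near=> x'; split=> //; exists (z :: p); rewrite /= pn zp andbT; split=> //.
apply/existsP; exists l; rewrite metric_sym.
near: x'; exact: (F_cont l x _ (near_mdist_lt xz)).
Unshelve. all: by end_near. Qed.

Context (X_compact : compact [set: X]) (F_cont : forall l, continuous (F l)).
Context (F_ct : chain_transitive F).

Lemma chain_period_gt0 x e : 0 < e -> (0 < chain_period F e)%N.
Proof.
move=> e0; have [n xn] := F_ct x x e0; have [dvd _] := chain_periodP x F_ct e0.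
have := dvd _ xn; case: (chain_period F e) => //.
by rewrite dvd0n => /eqP n0; case: xn; rewrite n0.
Qed.

Lemma dvdn_chain_period d e x : 0 < d -> d <= e ->
  (chain_period F e %| chain_period F d)%N.
Proof.
move=> d0 de; have e0 := lt_le_trans d0 de.
have [ge _] := chain_periodP x F_ct e0.
have [gd mind] := chain_periodP x F_ct d0.
have k0 := chain_period_gt0 x d0.
(* Maximality in [is_gcd] is by size: the lcm divides every [d]-loop length, so it cannot exceed the
   [d]-period. *)
suff <- : lcmn (chain_period F e) (chain_period F d) = chain_period F d.
  exact: dvdn_lcml.
have k0' := chain_period_gt0 x e0.
apply/eqP; rewrite eqn_leq [X in _ && X]dvdn_leq ?lcmn_gt0
  ?k0' ?k0 ?dvdn_lcmr// andbT.
by apply: mind => n xn; rewrite dvdn_lcm gd// ge//; exact: eps_chain_le xn.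
Qed.


(** Lengths that serve at a point serve near it, and raising [M] keeps them admissible, so
    compactness yields one bound. *)
Lemma eps_chain_bounded e x0 : 0 < e -> exists M, forall x,
  (exists2 n, (n <= M)%N & eps_chain F e n x0 x) /\
  (exists2 n, (n <= M)%N & eps_chain F e n x x0).
Proof.
move=> e0; pose P M x := (exists2 n, (n <= M)%N & eps_chain F e n x0 x) /\
  (exists2 n, (n <= M)%N & eps_chain F e n x x0).
have /compact_near_coveringP /(_ nat \oo P) cov := X_compact.
suff /cov[M _ MP] : forall x, [set: X] x ->
    \forall x' \near x & M \near \oo, P M x'.
  by exists M => x; exact: (MP M (leqnn M) x I).
move=> x _; have [n x0x] := F_ct x0 x e0; have [m xx0] := F_ct x x0 e0.
exists ([set x' | eps_chain F e n x0 x' /\ eps_chain F e m x' x0],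
        [set M | (maxn n m <= M)%N]).
  split; last exact: nbhs_infty_ge.
  by apply: filterI; [exact: near_eps_chainr|exact: near_eps_chainl].
by move=> [x' M] [/= [x0x' x'x0]]; rewrite geq_max => /andP[nM mM]; split;
  [exists n|exists m].
Qed.

(* The phase of x is the class modulo k_e of the lengths of the e-chains from
   x0 to x, represented in [0, k_e[. *)
Definition phase x0 e x : nat :=
  (xget 0 [set n | eps_chain F e n x0 x] %% chain_period F e)%N.

(** A return chain from [y] to [x0] closes both the chosen chain to [y] and the chosen chain to [x]
    prolonged by the given one; the period divides both loop lengths. Chain transitivity rules out
    the default of [xget]. *)
Lemma phase_chain x0 e n x y : 0 < e -> eps_chain F e n x y ->
  phase x0 e y = ((phase x0 e x + n) %% chain_period F e)%N.
Proof.
move=> e0 xy; rewrite /phase modnDml.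
case: xgetP => [b _ /= x0y|/(_ _ _)]; last first.
  by have [b x0y] := F_ct x0 y e0; move=> /(_ b).
case: xgetP => [a _ /= x0x|/(_ _ _)]; last first.
  by have [a x0x] := F_ct x0 x e0; move=> /(_ a).
have [c yx0] := F_ct y x0 e0.
have [dvd _] := chain_periodP x0 F_ct e0.
have /dvd bc := eps_chain_trans x0y yx0.
have /dvd anc := eps_chain_trans (eps_chain_trans x0x xy) yx0.
apply/eqP; rewrite -(eqn_modDr c); move: bc anc; rewrite /dvdn.
by move=> /eqP -> /eqP ->.
Qed.

Lemma phase0 x0 e : 0 < e -> phase x0 e x0 = 0%N.
Proof.
move=> e0; have [dvd _] := chain_periodP x0 F_ct e0.
rewrite /phase; case: xgetP => [a _ /dvd|_]; last exact: mod0n.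
by move/eqP.
Qed.

Lemma phase_chain0 x0 e n x : 0 < e -> eps_chain F e n x0 x ->
  phase x0 e x = (n %% chain_period F e)%N.
Proof. by move=> e0 /(phase_chain x0 e0) ->; rewrite phase0. Qed.

Lemma phase_lt x0 e x : 0 < e -> (phase x0 e x < chain_period F e)%N.
Proof. by move=> e0; rewrite ltn_pmod// (chain_period_gt0 x). Qed.

Lemma phase_map x0 e l x : 0 < e ->
  phase x0 e (F l x) = ((phase x0 e x).+1 %% chain_period F e)%N.
Proof.
by move=> e0; rewrite (phase_chain x0 e0 (eps_chain_map l x e0)) addn1.
Qed.

Lemma phase_ifs_power x0 e k (t : k.-tuple L) x : 0 < e ->
  phase x0 e (ifs_power F t x) = ((phase x0 e x + k) %% chain_period F e)%N.
Proof.
move=> e0; rewrite /ifs_power -{2}(size_tuple t).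
elim: (tval t) x => [x|l s IHs x] /=.
  by rewrite addn0 modn_small// phase_lt.
by rewrite IHs phase_map// modnDml addSnnS.
Qed.

Lemma phase_surj x0 e n : (0 < #|L|)%N -> 0 < e -> (n < chain_period F e)%N ->
  exists x, phase x0 e x = n.
Proof.
move=> /card_gt0P[l _] e0 nk; exists (ifs_power F (nseq_tuple n l) x0).
by rewrite phase_ifs_power// phase0// modn_small.
Qed.

Lemma phase_le x0 d e x : 0 < d -> d <= e ->
  phase x0 e x = (phase x0 d x %% chain_period F e)%N.
Proof.
move=> d0 de; have e0 := lt_le_trans d0 de.
have [n x0x] := F_ct x0 x d0.
rewrite (phase_chain0 e0 (eps_chain_le de x0x)) (phase_chain0 d0 x0x).
by rewrite modn_dvdm// (dvdn_chain_period x0).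
Qed.

Lemma near_phase x0 e x : 0 < e ->
  \forall y \near x, phase x0 e y = phase x0 e x.
Proof.
move=> e0; have [n x0x] := F_ct x0 x e0.
near=> y; rewrite (phase_chain0 e0 x0x); apply: phase_chain0 => //.
by near: y; exact: near_eps_chainr.
Unshelve. all: by end_near. Qed.

Lemma clopen_phase x0 e n : 0 < e -> clopen [set x | phase x0 e x = n].
Proof.
move=> e0; have o P : open [set x | P (phase x0 e x)].
  rewrite openE => x /= Px; rewrite /interior; near=> y.
  by rewrite /= (near (near_phase x0 x e0) y).
by split; [exact: (o (eq^~ n))|rewrite -openC; exact: (o (fun m => m <> n))].
Unshelve. all: by end_near. Qed.

(** Every chain between points of equal phase has length divisible by the period, and chain
    transitivity supplies one. *)
Lemma eps_simP x0 e x y : 0 < e ->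
  eps_sim F e x y <-> phase x0 e x = phase x0 e y.
Proof.
move=> e0; split=> [[m m0 xy]|exy].
  by rewrite (phase_chain x0 e0 xy) addnC modnMDl modn_small ?phase_lt.
have [n xy] := F_ct x y e0; have /esym := phase_chain x0 e0 xy.
rewrite -exy => /eqP; rewrite -{2}(modn_small (phase_lt x0 x e0)).
rewrite -{2}[phase x0 e x]addn0 eqn_modDl mod0n => /dvdnP[m nm].
exists m; last by rewrite -nm.
by case: xy; rewrite nm muln_gt0 => /andP[].
Qed.

End phase.

(** * Shadowing by compositions, and chains of prescribed length *)

Section shadowing.
Context {R : realType} {X : metricType R} {L : finType} (F : L -> X -> X).
Implicit Types (e d : R) (x y z : X) (n m k : nat).
Context (X_compact : compact [set: X]) (F_cont : forall l, continuous (F l)).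
Context (F_ct : chain_transitive F).

Lemma uniform_equicontinuity e : 0 < e -> exists2 d, 0 < d &
  forall l x y, mdist x y < d -> mdist (F l x) (F l y) < e.
Proof.
move=> e0.
pose P d x := forall l y, mdist x y < d -> mdist (F l x) (F l y) < e.
have /compact_near_coveringP /(_ _ 0^'+ P) cov := X_compact.
suff /cov : forall x, [set: X] x -> \forall x' \near x & d \near 0^'+, P d x'.
  move=> {}cov; have [d [d0 dP]] : exists d, 0 < d /\ [set: X] `<=` P d.
    apply: (@filter_ex _ 0^'+); apply: filterI => //.
    exact: nbhs_right_gt.
  by exists d => // l x y; exact: dP.
move=> x _.
have : \forall x' \near x, forall l, mdist (F l x') (F l x) < e / 2.
  apply: filter_forall => l.
  have Flx : mdist (F l x) (F l x) < e / 2 by rewrite mdistxx divr_gt0.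
  exact: (F_cont (near_mdist_lt Flx)).
move=> /metricType_numDomainType.nbhs_mdistP[r /= r0 xr].
(* Points within [r / 2] of [x'] are within [r] of [x], so both images lie within [e / 2] of
   [F l x]; finiteness of [L] gave one [r] for all maps. *)
exists ([set x' | mdist x' x < r / 2], [set d | d < r / 2]).
  split; last by apply: nbhs_right_lt; rewrite divr_gt0.
  by apply: near_mdist_lt; rewrite mdistxx divr_gt0.
move=> [x' d] [/= xx' dr] l y x'y.
have xx'r : mdist x x' < r.
  by rewrite metric_sym (lt_trans xx')// ltr_pdivrMr// ltr_pMr// ltr1n.
rewrite (le_lt_trans (metric_triangle _ (F l x) _))// (splitr e) ltrD//.
  exact: xr.
rewrite metric_sym; apply: xr => /=.
rewrite (le_lt_trans (metric_triangle _ x' _))// (splitr r) ltrD//.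
  by rewrite metric_sym.
exact: lt_trans x'y dr.
Qed.

(** Induction on the length, appending the last map: an earlier error below [c] costs at most
    [e / 2] through that map, and the last jump costs the other half. *)
Lemma eps_chain_shadow k e : (0 < k)%N -> 0 < e -> exists2 d, 0 < d &
  forall x y, eps_chain F d k x y ->
    exists t : k.-tuple L, mdist y (ifs_power F t x) < e.
Proof.
case: k => // k _; elim: k e => [|k IHk] e e0.
  exists e => // x y /eps_chain_cons[z [p [/size0nil-> /existsP[l xz] _ /= <-]]].
  by exists [tuple l].
have e20 : 0 < e / 2 by rewrite divr_gt0.
have [c c0 Fc] := uniform_equicontinuity e20.
have [d d0 dP] := IHk _ c0.
exists (Num.min d (e / 2)); first by rewrite lt_min d0.
move=> x y xy; rewrite -(addn1 k.+1) in xy.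
have [//|//|z xz zy] := eps_chain_split _ _ xy.
have [|t zt] := dP x z.
  by apply: eps_chain_le xz; rewrite ge_min lexx.
have /eps_chain_cons[z' [p [/size0nil-> /existsP[l zy'] _ /= z'y]]] := zy.
rewrite {z'}z'y in zy'.
exists [tuple of rcons t l].
rewrite /ifs_power/= -cats1 foldl_cat/=.
rewrite (le_lt_trans (metric_triangle _ (F l z) _))// (splitr e) ltrD//.
  by rewrite (lt_le_trans zy')// ge_min lexx orbT.
exact: Fc.
Qed.

(** The chain is cut into blocks of length [k]: block ends stay in [E], and each block is one
    [e]-step of the restricted power. *)
Lemma eps_chain_restrict (E : set X) k
    (FE : forall t : k.-tuple L, set_fun E E (ifs_power F t)) d e :
  (0 < k)%N ->
  (forall x y, eps_chain F d k x y ->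
    exists t : k.-tuple L, mdist y (ifs_power F t x) < e) ->
  (forall x y, E x -> eps_chain F d k x y -> E y) ->
  forall n (x y : E), (0 < n)%N ->
    eps_chain F d (n * k) (set_val x) (set_val y) ->
    eps_chain (ifs_restrict FE) e n x y.
Proof.
move=> k0 shadow Eclosed; elim=> // -[_|n IHn] x y _.
  rewrite mul1n => /shadow[t xt]; split=> //; exists [:: y]; split=> //=.
  by rewrite andbT; apply/existsP; exists t.
rewrite mulSn => xy; have [//||z xz zy] := eps_chain_split _ _ xy.
  by rewrite muln_gt0.
have Ez : z \in E by rewrite inE; apply: Eclosed xz; exact: set_valP.
pose z' : E := SigSub Ez.
rewrite -(add1n n.+1); suff xz' : eps_chain (ifs_restrict FE) e 1 x z'.
  by apply: eps_chain_trans xz' _; exact: IHn.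
have [t xt] := shadow _ _ xz; split=> //; exists [:: z']; split=> //=.
by rewrite andbT; apply/existsP; exists t.
Qed.

Lemma eps_chain_long x0 e : 0 < e -> exists N, forall x y n,
  phase F x0 e x = phase F x0 e y -> (N < n)%N ->
  eps_chain F e (n * chain_period F e) x y.
Proof.
move=> e0; set k := chain_period F e.
have k0 : (0 < k)%N := chain_period_gt0 F_ct x0 e0.
have [M MP] := eps_chain_bounded X_compact F_cont F_ct x0 e0.
have [dvd gmax] := chain_periodP x0 F_ct e0.
(* Chains have positive length, so [0] is adjoined to obtain a submonoid. *)
pose S := [set n | n = 0%N \/ eps_chain F e n x0 x0].
have SD m n : S m -> S n -> S (m + n)%N.
  move=> [->//|mx] [->|nx]; first by rewrite addn0; right.
  by right; exact: eps_chain_trans mx nx.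
have [|//||N NP] := @numerical_semigroup S k _ _ _ SD.
- split=> [n [->|/dvd]//|d dS].
  by apply: gmax => n xn; apply: dS; right.
- by left.
(* The chain goes from [x] to [x0], loops there, and goes on to [y]. The outer pieces have total
   length [q * k] with [q <= M + M], so [n - q] is at least [N] and positive: the loop is a genuine
   chain. *)
exists (N + (M + M))%N => x y n xy Nn.
have [_ [a aM xx0]] := MP x; have [[b bM x0y] _] := MP y.
have kab : (k %| a + b)%N.
  have := phase_chain F_ct x0 e0 (eps_chain_trans xx0 x0y).
  rewrite -xy -[LHS](modn_small (phase_lt F_ct x0 x e0)).
  rewrite -{1}[phase _ _ _ _]addn0 => /eqP.
  by rewrite eqn_modDl mod0n eq_sym.
move: kab => /dvdnP[q abq].
have qM : (q <= M + M)%N.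
  by rewrite (leq_trans _ (leq_add aM bM))// abq leq_pmulr.
have qn : (q <= n)%N.
  by rewrite (leq_trans qM)// (leq_trans _ (ltnW Nn))// leq_addl.
have [|/eqP|loop] := NP (n - q)%N.
- by rewrite leq_subRL// addnC (leq_trans _ (ltnW Nn))// leq_add2l.
- rewrite muln_eq0 (gtn_eqF k0) orbF subn_eq0 leqNgt => /negP[].
  by rewrite (leq_ltn_trans qM)// (leq_ltn_trans _ Nn)// leq_addl.
have := eps_chain_trans (eps_chain_trans xx0 loop) x0y.
by rewrite addnAC abq -mulnDl subnKC.
Qed.

End shadowing.

(** * Factor maps onto adding machines *)

Lemma adding_dist_le (R : realType) (a : nat -> nat) (x y : adding_space R a) n :
  (forall i, (i < n)%N -> x i = y i) -> mdist x y <= (2 ^+ n)^-1.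
Proof.
move=> xy; rewrite -[mdist x y]/(adding_dist x y) /adding_dist.
pose t i : R := (x i != y i)%:R / 2 ^+ i.+1.
have t0 i : 0 <= t i by rewrite divr_ge0 ?ler0n ?exprn_ge0.
have nd : nondecreasing_seq (series t).
  by apply/nondecreasing_seqP => m; rewrite /series /= big_nat_recr//= lerDl.
(* The added term is the geometric tail still to come; it pays for the next summand in the
   induction. *)
have tail j : series t (n + j)%N + (2 ^+ (n + j))^-1 <= (2 ^+ n)^-1.
  elim: j => [|j]; rewrite ?addn0 ?addnS.
    rewrite /series /= big_nat big1 ?add0r// => i /andP[_ ilt].
    by rewrite /t xy// eqxx mul0r.
  apply: le_trans; rewrite /series /= big_nat_recr//= -addrA lerD2l.
  rewrite [leRHS](_ : _ = 1 / 2 ^+ (n + j).+1 + (2 ^+ (n + j).+1)^-1).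
    by rewrite lerD2r /t ler_wpM2r ?invr_ge0 ?exprn_ge0// lern1 leq_b1.
  by rewrite [LHS]splitr div1r exprS invfM mulrC.
have le_t m : series t m <= (2 ^+ n)^-1.
  apply: le_trans (tail m); rewrite (le_trans (nd m (n + m)%N _)) ?leq_addl//.
  by rewrite lerDl invr_ge0 exprn_ge0.
apply: limr_le; last exact: nearW.
apply: nondecreasing_is_cvgn => //; exists (2 ^+ n)^-1.
by move=> _ [m _ <-]; exact: le_t.
Qed.

(* A tower of factors of F onto the rotations of Z/K_i, with K_0 = 1 and K_i a
   proper divisor of K_{i+1}: the coordinate phi_i is read as the value of the
   first i digits in the mixed radix system of base (K_{i+1} / K_i)_i. *)
Lemma tower_factors_to_adding_machine (R : realType) (X : metricType R)
    (L : finType) (F : L -> X -> X) (K : nat -> nat) (phi : nat -> X -> nat) :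
  compact [set: X] -> K 0%N = 1%N ->
  (forall i, (K i %| K i.+1)%N) -> (forall i, (K i < K i.+1)%N) ->
  (forall i x, (phi i x < K i)%N) ->
  (forall i x, phi i x = (phi i.+1 x %% K i)%N) ->
  (forall i l x, phi i (F l x) = ((phi i x).+1 %% K i)%N) ->
  (forall i x, \forall y \near x, phi i y = phi i x) ->
  (forall i n, (n < K i)%N -> exists x, phi i x = n) ->
  factors_to_adding_machine F.
Proof.
move=> X_compact K0 Kdvd Klt phi_lt phi_mod phiF phi_near phi_surj.
have K_gt0 i : (0 < K i)%N.
  by case: i => [|i]; [rewrite K0|exact: leq_ltn_trans (Klt i)].
pose a i := (K i.+1 %/ K i)%N.
have Ka i : K i.+1 = (a i * K i)%N by rewrite /a divnK.
have a_gt1 i : (1 < a i)%N.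
  by have := Klt i; rewrite Ka -{1}[K i]mul1n ltn_pmul2r.
have h_lt i x : (phi i.+1 x %/ K i < a i)%N by rewrite ltn_divLR// -Ka.
pose h x : adding_space R a := fun i => Ordinal (h_lt i x).
exists a, a_gt1, h.
have phi_rec i x : phi i.+1 x = (h x i * K i + phi i x)%N.
  by rewrite /= (phi_mod i) -divn_eq.
have phi_mono n m x y : (n <= m)%N -> phi m x = phi m y -> phi n x = phi n y.
  move=> /subnK <-; elim: (m - n)%N => // j IHj; rewrite addSn => e.
  by apply: IHj; rewrite phi_mod e -phi_mod.
split.
(* Continuity: the first [n] digits depend only on [phi n], which is locally constant. *)
- move=> x; apply/metricType_numDomainType.cvgrPdist_lt => e e0.
  have [n _ ne] := near_infty_natSinv_expn_lt (PosNum e0).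
  near=> y; have yx : phi n y = phi n x by near: y; exact: phi_near.
  apply: le_lt_trans (ne n (leqnn n)); rewrite div1r.
  apply: adding_dist_le => i i_n; apply/val_inj => /=.
  by rewrite (phi_mono i.+1 n y x).
(* [v n] is the integer with the first [n] digits of [z]; a preimage of [z] must satisfy
   [phi n x = v n] for all [n]. *)
- move=> z _; pose v := fix v n :=
    if n is n'.+1 then (z n' * K n' + v n')%N else 0%N.
  have v_lt n : (v n < K n)%N.
    elim: n => [|n IHn] /=; first by rewrite K0.
    rewrite Ka (@leq_trans ((z n).+1 * K n))//; last by rewrite leq_pmul2r.
    by rewrite mulSn addnC ltn_add2r.
  have v_mod n : v n = (v n.+1 %% K n)%N by rewrite /= modnMDl modn_small.
  suff [x xz] : exists x, forall n, phi n x = v n.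
    exists x => //; apply: functional_extensionality_dep => i; apply/val_inj.
    by rewrite /= xz /= divnMDl// divn_small// addn0.
  (* A mismatch at level [n] persists nearby and at higher levels, so by compactness one level [N]
     would mismatch everywhere, against the surjectivity of [phi N]. *)
  apply: contrapT => /forallNP xv.
  have /compact_near_coveringP := X_compact.
  move=> /(_ nat \oo (fun n x => phi n x <> v n)) cov.
  have /cov[N _ NP] : forall x, [set: X] x ->
      \forall x' \near x & n \near \oo, phi n x' <> v n.
    move=> x _; have /existsNP[n xn] := xv x.
    exists ([set x' | phi n x' = phi n x], [set m | (n <= m)%N]).
      by split; [exact: phi_near|exact: nbhs_infty_ge].
    move=> [x' m] [/= xx' /subnK nm] mv; apply: xn; rewrite -xx'.
    move: mv; rewrite -nm; elim: (m - n)%N => // j IHj; rewrite addSn => e.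
    by apply: IHj; rewrite phi_mod e -v_mod.
  have [x xN] := phi_surj _ _ (v_lt N).
  exact: NP N (leqnn N) x I xN.
- move=> l; apply/funext => x; apply: functional_extensionality_dep => i.
  (* The digit 1 of [adding_one] acts as a carry into coordinate 0. A carry reaches [j] exactly when
     all lower digits are maximal, that is, when [phi j x] is [K j - 1]. *)
  have carry_eq j : (adding_one (R := R) a_gt1 j
      + adding_carry (h x) (adding_one a_gt1) j)%N = ((phi j x).+1 == K j) :> nat.
    elim: j => [|j IHj].
      by have := phi_lt 0%N x; rewrite K0 ltnS leqn0 => /eqP ->.
    rewrite [val _]/= add0n [adding_carry _ _ _]/= -addnA IHj.
    congr nat_of_bool; rewrite phi_rec Ka divnMDl//.
    rewrite (divn_small (phi_lt j x)) addn0.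
    have pj := phi_lt j x; have hj := ltn_ord (h x j).
    case: eqP => [pK|/eqP pK].
      by rewrite addn1 -addnS pK addnC -mulSn eqn_pmul2r// eqn_leq hj.
    rewrite addn0 leqNgt hj; apply/esym/negbTE.
    rewrite neq_ltn -addnS (@leq_trans ((h x j).+1 * K j))//.
      by rewrite mulSn addnC ltn_add2r ltn_neqAle pK.
    by rewrite leq_pmul2r.
  apply/val_inj; rewrite /= -addnA carry_eq phiF Ka -modn_divl.
  congr (_ %% _)%N; rewrite phi_rec -addnS divnMDl// (divnMDl _ _ (K_gt0 i)).
  rewrite (divn_small (phi_lt i x)) addn0; congr addn.
  have := phi_lt i x; case: eqP => [-> _|/eqP pK p_lt].
    by rewrite divnn K_gt0.
  by rewrite divn_small// ltn_neqAle pK.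
Unshelve. all: by end_near. Qed.

(** * Unbounded and maximal periods *)

Section period.
Context {R : realType} {X : metricType R} {L : finType} (F : L -> X -> X).
Implicit Types (e d : R) (x y z : X) (n m k : nat).
Context (X_compact : compact [set: X]) (F_cont : forall l, continuous (F l)).
Context (F_ct : chain_transitive F).

Lemma unbounded_period_factors_to_adding_machine x0 : (0 < #|L|)%N ->
  (forall e, 0 < e ->
    exists2 d, 0 < d & (chain_period F e < chain_period F d)%N) ->
  factors_to_adding_machine F.
Proof.
move=> L_gt0 unb.
(* Positivity sits under the existential so that [choice] gives a total function. The bound [d <= e]
   is automatic: a larger [d] would have a period dividing that of [e]. *)
have next e : exists d, 0 < e ->
    [/\ 0 < d, d <= e & (chain_period F e < chain_period F d)%N].
  have [e0|] := ltP 0 e; last by exists e.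
  have [d d0 ed] := unb e e0; exists d => _; split=> //.
  rewrite leNgt; apply/negP => /ltW /(dvdn_chain_period F_ct x0 e0) /dvdn_leq.
  by rewrite (chain_period_gt0 F_ct x0 e0) leqNgt ed => /(_ isT).
have [f f_next] := choice next.
(* Starting at [f 1] makes the period at [eps 0] exceed 1, the value of [K 0] at the trivial base of
   the tower. *)
pose eps i := iter i.+1 f 1.
have eps_gt0 i : 0 < eps i.
  by rewrite /eps; elim: i.+1 => //= j /f_next[].
have eps_le i : eps i.+1 <= eps i by have [] := f_next _ (eps_gt0 i).
pose K i := if i is i'.+1 then chain_period F (eps i') else 1%N.
pose phi i x := if i is i'.+1 then phase F x0 (eps i') x else 0%N.
apply: (@tower_factors_to_adding_machine _ _ _ F K phi X_compact).
- by [].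
- by case=> [|i] //=; exact: dvdn_chain_period.
- case=> [|i] /=; last by have [] := f_next _ (eps_gt0 i).
  have [_ _] := f_next 1 ltr01; apply: leq_ltn_trans.
  exact: chain_period_gt0.
- by case=> [|i] x //=; exact: phase_lt.
- by case=> [|i] x /=; [rewrite modn1|exact: phase_le].
- by case=> [|i] l x /=; [rewrite modn1|exact: phase_map].
- by case=> [|i] x /=; [exact: nearW|exact: near_phase].
- case=> [|i] n /=; last exact: phase_surj.
  by rewrite ltnS leqn0 => /eqP ->; exists x0.
Qed.

Section maximal_period.
Context (x0 : X) (e0 : R) (L_gt0 : (0 < #|L|)%N) (e0_gt0 : 0 < e0).
Context (period_max :
  forall e, 0 < e -> (chain_period F e <= chain_period F e0)%N).

Let k := chain_period F e0.

Lemma maximal_period_eq d : 0 < d -> d <= e0 -> chain_period F d = k.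
Proof.
move=> d0 de; apply/eqP; rewrite eqn_leq period_max//= dvdn_leq//.
  exact: chain_period_gt0.
exact: dvdn_chain_period.
Qed.

Lemma maximal_period_phase d x : 0 < d -> d <= e0 ->
  phase F x0 d x = phase F x0 e0 x.
Proof.
move=> d0 de; rewrite (phase_le F_ct x0 x d0 de) -/k -(maximal_period_eq d0 de).
by rewrite modn_small// phase_lt.
Qed.

(** At scales below [e0] the phases coincide with the [e0]-phase; at larger scales they are
    reductions of it. *)
Lemma maximal_period_class x :
  chain_class F x = [set y | phase F x0 e0 y = phase F x0 e0 x].
Proof.
apply/seteqP; split=> y /=.
  by move=> /(_ e0 e0_gt0) /(eps_simP F_ct x0 x y e0_gt0).
move=> yx e e_gt0; apply/(eps_simP F_ct x0 _ _ e_gt0).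
have [e0e|/ltW ee0] := leP e0 e; last by rewrite !maximal_period_phase.
by rewrite !(phase_le F_ct x0 _ e0_gt0 e0e) yx.
Qed.

Lemma maximal_period_bij : set_bij setT (chain_classes F)
  (fun j : 'I_k => [set x | phase F x0 e0 x = j]).
Proof.
split.
- move=> j _; have [x xj] := phase_surj F_ct x0 L_gt0 e0_gt0 (ltn_ord j).
  by exists x => //; rewrite maximal_period_class xj.
- move=> i j _ _ ij; apply/val_inj.
  have [x xi] := phase_surj F_ct x0 L_gt0 e0_gt0 (ltn_ord i).
  have : [set x | phase F x0 e0 x = i] x by [].
  by rewrite ij /= xi.
- move=> _ [x _ <-]; exists (Ordinal (phase_lt F_ct x0 x e0_gt0)) => //=.
  by rewrite maximal_period_class.
Qed.

Lemma maximal_period_permutes : cyclically_permutes F k (chain_classes F).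
Proof.
exists (fun j : 'I_k => [set x | phase F x0 e0 x = j]); split.
- exact: maximal_period_bij.
- by move=> i j _ _ [x [/= xi xj]]; apply/val_inj; rewrite /= -xi -xj.
- by move=> l j _ [x /= xj <-]; rewrite (phase_map F_ct)// xj.
Qed.

Lemma maximal_period_mixing x : power_chain_mixing_on F k (chain_class F x).
Proof.
have phaseD d n y z : 0 < d -> d <= e0 -> eps_chain F d (n * k) y z ->
    phase F x0 e0 z = phase F x0 e0 y.
  move=> d0 de /(eps_chain_le de) /(phase_chain F_ct x0 e0_gt0) ->.
  by rewrite addnC modnMDl modn_small// phase_lt.
have FE (t : k.-tuple L) :
    set_fun (chain_class F x) (chain_class F x) (ifs_power F t).
  move=> y; rewrite maximal_period_class /= => <-.
  by rewrite (phase_ifs_power F_ct)// modnDr modn_small// phase_lt.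
exists FE => e e_gt0.
have k0 : (0 < k)%N by exact: chain_period_gt0.
have [c c0 shadow] := eps_chain_shadow X_compact F_cont k0 e_gt0.
(* [c] serves the shadowing; [e0] makes the [d]-period equal to [k] and the [d]-phase equal to the
   [e0]-phase. *)
pose d := Num.min c e0.
have d0 : 0 < d by rewrite lt_min c0.
have dc : d <= c by rewrite ge_min lexx.
have de : d <= e0 by rewrite ge_min lexx orbT.
have [N NP] := eps_chain_long X_compact F_cont F_ct x0 d0.
(* The successor only makes the threshold positive, as [chain_mixing] demands. *)
exists N.+1 => // y z n Nn; have n0 : (0 < n)%N := leq_ltn_trans (leq0n _) Nn.
apply: (@eps_chain_restrict _ _ _ _ _ _ FE d) => //.
- by move=> u v /(eps_chain_le dc); exact: shadow.
- move=> u v; rewrite maximal_period_class -{1}[k]mul1n /= => <-.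
  exact: phaseD.
rewrite -(maximal_period_eq d0 de); apply: NP; last exact: ltnW.
have classP v : chain_class F x v -> phase F x0 e0 v = phase F x0 e0 x.
  by rewrite maximal_period_class.
by rewrite !maximal_period_phase// (classP _ (set_valP y)) (classP _ (set_valP z)).
Qed.

End maximal_period.

End period.

Theorem theorem4p6 (R : realType) (X : metricType R) (L : finType)
    (F : L -> X -> X)
    (X_neq0 : [set: X] !=set0) (X_compact : compact [set: X])
    (L_gt0 : (0 < #|L|)%N) (F_cont : forall l, continuous (F l))
    (F_ct : chain_transitive F) :
  (exists k : nat,
     [/\ (0 < k)%N,
         (chain_classes F #= `I_k)%card,
         forall C, chain_classes F C -> closed C /\ open C,
         cyclically_permutes F k (chain_classes F) &
         forall C, chain_classes F C -> power_chain_mixing_on F k C])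
  \/ factors_to_adding_machine F.
Proof.
have [x0 _] := X_neq0.
have [[e0 e0_gt0 period_max]|unb] := pselect (exists2 e0, 0 < e0 &
    forall e, 0 < e -> (chain_period F e <= chain_period F e0)%N); last first.
  right; apply: unbounded_period_factors_to_adding_machine => // e e_gt0.
  apply: contrapT => bounded; apply: unb; exists e => // d d_gt0.
  by rewrite leqNgt; apply/negP => ed; apply: bounded; exists d.
left; exists (chain_period F e0); split.
- exact: chain_period_gt0.
- apply/card_esym/(card_eq_trans card_II)/card_set_bijP.
  exact: ex_intro (maximal_period_bij F_ct x0 L_gt0 e0_gt0 period_max).
- move=> _ [x _ <-]; rewrite (maximal_period_class F_ct x0 e0_gt0 period_max).
  by have [] := clopen_phase F_ct x0 (phase F x0 e0 x) e0_gt0.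
- exact: maximal_period_permutes.
- move=> _ [x _ <-].
  exact: (maximal_period_mixing X_compact F_cont F_ct x0).
Qed.
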